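(* Let $k\ge 2$ and $X\subseteq V(G_k)$. If $\operatorname{mm}(X)<k$, then one of $X$ and $V(G_k)\setminus X$ is small.
   Context: $G_k$ is the $k\times k$-grid with vertex set $\{(i,j):1\le i,j\le k\}$ and edges $(i,j)(i',j')$ with $|i-i'|+|j-j'|=1$. $C_i=\{(i,j):1\le j\le k\}$ and $R_j=\{(i,j):1\le i\le k\}$. For $X\subseteq V(G_k)$, $\operatorname{mm}(X)$ is the size of a maximum matching in $G_k$ among the edges with one end in $X$ and the other in $V(G_k)\setminus X$. A set $X\subseteq V(G_k)$ is small if $\operatorname{mm}(X)<k$ and $R_i\not\subseteq X$ for all $i=1,\dots,k$. *)

(* Defs.v *)
From mathcomp Require Export all_boot all_order all_algebra.

Set Implicit Arguments.
Unset Strict Implicit.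
Unset Printing Implicit Defensive.

Local Open Scope nat_scope.

(* Coordinates are shifted by one: (i, j) with 1 <= i, j <= k is represented
   by (i - 1, j - 1) in 'I_k * 'I_k. *)
Definition grid_vertex (k : nat) : finType := ('I_k * 'I_k)%type.

(* `|m - n|%N is the distance between m and n, not truncated subtraction. *)
Definition grid_adj (k : nat) : rel (grid_vertex k) :=
  fun u v => `|u.1 - v.1| + `|u.2 - v.2| == 1.

Definition grid_edges (k : nat) : {set {set grid_vertex k}} :=
  [set e | [exists u, exists v, grid_adj u v && (e == [set u; v])]].

Definition grid_row (k : nat) (j : 'I_k) : {set grid_vertex k} :=
  [set v | v.2 == j].

Definition crossing_edges (k : nat) (X : {set grid_vertex k}) :
    {set {set grid_vertex k}} :=
  [set e in grid_edges k
     | [exists u in X, exists v in ~: X, e == [set u; v]]].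

Definition grid_matching (k : nat) (M : {set {set grid_vertex k}}) : bool :=
  (M \subset grid_edges k) && trivIset M.

Definition mm (k : nat) (X : {set grid_vertex k}) : nat :=
  \max_(M : {set {set grid_vertex k}}
        | grid_matching M && (M \subset crossing_edges X)) #|M|.

Definition small (k : nat) (X : {set grid_vertex k}) : Prop :=
  mm X < k /\ forall j : 'I_k, ~ (grid_row j \subset X).

(* Main.v *)
Require Import Defs.
From mathcomp Require Import all_boot all_order all_algebra.

Local Open Scope nat_scope.

(** If neither [X] nor its complement is small, some row lies in [X] and another
    one avoids [X].  Every column then meets both sides, hence contains an edge
    crossing between them, and the [k] edges chosen in the [k] columns form a
    matching. *)

(** Discrete intermediate value principle, by induction on [n]: either the value changes at the last
    step, or [P m] and [P n] already differ for the shorter interval. *)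
Lemma pred_change_step (P : pred nat) (m n : nat) :
  m <= n -> P m != P n -> exists2 i, m <= i < n & P i != P i.+1.
Proof.
elim: n => [|n IHn]; first by rewrite leqn0 => /eqP ->; rewrite eqxx.
rewrite leq_eqVlt => /predU1P[-> | lt_mn]; first by rewrite eqxx.
have [-> nPS | nPmn _] := eqVneq (P m) (P n).
  by exists n; rewrite ?leqnn ?andbT.
have [i /andP[le_mi lt_in] nPi] := IHn lt_mn nPmn.
by exists i; rewrite // le_mi ltnW.
Qed.

Lemma ord_pred_change (k : nat) (P : pred 'I_k) (a b : 'I_k) :
  P a -> ~~ P b -> exists c d : 'I_k, [/\ P c, ~~ P d & `|c - d| = 1].
Proof.
case: k P a b => [|k] P a b; first by case: a.
(* [Q] extends [P] to all naturals by a default value; the bound [i.+1 < k.+1] below keeps the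
   change inside the range where [inord] is faithful. *)
move=> Pa nPb; pose Q n := P (inord n).
have [i lt_ik nQ] : exists2 i, i.+1 < k.+1 & Q i != Q i.+1.
  have Qab : Q a != Q b by rewrite /Q !inord_val Pa (negbTE nPb).
  have [le_ab | /ltnW le_ba] := leqP a b.
    have [i /andP[_ lt_ib] nQ] := pred_change_step _ _ _ le_ab Qab.
    by exists i; rewrite // (leq_ltn_trans lt_ib).
  rewrite eq_sym in Qab.
  have [i /andP[_ lt_ia] nQ] := pred_change_step _ _ _ le_ba Qab.
  by exists i; rewrite // (leq_ltn_trans lt_ia).
have vi : (inord i : 'I_k.+1) = i :> nat by rewrite inordK // ltnW.
have vi1 : (inord i.+1 : 'I_k.+1) = i.+1 :> nat by rewrite inordK.
move: nQ; rewrite /Q.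
case Pi: (P (inord i)); case Pi1: (P (inord i.+1)) => // _.
  by exists (inord i), (inord i.+1); rewrite Pi Pi1 vi vi1 distnS.
by exists (inord i.+1), (inord i); rewrite Pi Pi1 vi vi1 distnC distnS.
Qed.

Lemma crossing_edgesC (k : nat) (X : {set grid_vertex k}) :
  crossing_edges (~: X) = crossing_edges X.
Proof.
apply/setP=> e; rewrite !inE; congr (_ && _).
apply/exists_inP/exists_inP=> -[u uX /exists_inP[v vX /eqP ->]];
  exists v; rewrite ?setCK // in vX *; apply/exists_inP; exists u => //;
  by rewrite ?setCK // setUC.
Qed.

Lemma mmC (k : nat) (X : {set grid_vertex k}) : mm (~: X) = mm X.
Proof. by rewrite /mm crossing_edgesC. Qed.

(** Crossing edges are grid edges by definition, so [M] is one of the matchings over which the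
    maximum is taken. *)
Lemma leq_mm (k : nat) (X : {set grid_vertex k}) (M : {set {set grid_vertex k}}) :
  M \subset crossing_edges X -> trivIset M -> #|M| <= mm X.
Proof.
move=> sMX tiM; apply: (leq_bigmax_cond (F := fun N : {set _} => #|N|)).
rewrite /grid_matching tiM sMX !andbT (subset_trans sMX) //.
by apply/subsetP=> e; rewrite inE => /andP[].
Qed.

(** Going along column [i] from row [j] to row [j'], membership in [X] changes between two
    neighbours. Nonemptiness is recorded so that the edge determines its column. *)
Lemma column_crossing_edge (k : nat) (X : {set grid_vertex k}) (j j' : 'I_k) :
    grid_row j \subset X -> grid_row j' \subset ~: X ->
  forall i : 'I_k, exists2 e : {set grid_vertex k},
    e \in crossing_edges X & (e != set0) && [forall v in e, v.1 == i].
Proof.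
move=> /subsetP sjX /subsetP sj'X i.
have [] := @ord_pred_change k (fun a => (i, a) \in X) j j'.
- by apply: sjX; rewrite inE.
- by rewrite -in_setC; apply: sj'X; rewrite inE.
move=> c [d [cX dX cd1]]; exists [set (i, c); (i, d)]; last first.
  apply/andP; split; first by apply/set0Pn; exists (i, c); rewrite !inE eqxx.
  by apply/forall_inP=> v; rewrite !inE => /orP[] /eqP ->.
rewrite inE; apply/andP; split.
  rewrite inE; apply/existsP; exists (i, c); apply/existsP; exists (i, d).
  by rewrite /grid_adj /= distnn cd1 !eqxx.
apply/exists_inP; exists (i, c) => //; apply/exists_inP; exists (i, d) => //.
by rewrite inE.
Qed.

Lemma mm_split_rows (k : nat) (X : {set grid_vertex k}) (j j' : 'I_k) :
  grid_row j \subset X -> grid_row j' \subset ~: X -> k <= mm X.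
Proof.
move=> sjX sj'X.
have /fin_all_exists2[f fX fcol] := column_crossing_edge _ _ _ _ sjX sj'X.
have f1 i v : v \in f i -> v.1 = i.
  by have /andP[_ /forall_inP fi] := fcol i => /fi /eqP.
(* Any vertex of a common edge has first coordinate both [i] and [i']. *)
have f_inj : injective f.
  move=> i i' eq_f; have /andP[/set0Pn[v vi] _] := fcol i.
  by rewrite -(f1 i v vi); apply: f1; rewrite -eq_f.
have card_f : #|f @: 'I_k| = k by rewrite card_imset ?card_ord.
rewrite -{1}card_f; apply: leq_mm; first by apply/subsetP=> _ /imsetP[i _ ->].
(* Contrapositive: a shared vertex forces equal columns, hence equal edges. *)
apply/trivIsetP=> _ _ /imsetP[i _ ->] /imsetP[i' _ ->] neq_f.
rewrite -setI_eq0; apply: contraR neq_f => /set0Pn[v /setIP[/f1 vi /f1 vi']].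
by rewrite -vi vi'.
Qed.

Theorem lemma4p3 (k : nat) (X : {set grid_vertex k}) :
  2 <= k -> mm X < k -> small X \/ small (~: X).
Proof.
move=> _ mmX.
(* A row inside [X] selects the complement: a second row inside [~: X] would give [k <= mm X]. *)
have [/existsP[j sjX] | /existsPn nX] := boolP [exists j, grid_row j \subset X].
  right; split=> [|j' sj'X]; first by rewrite mmC.
  by have := mm_split_rows _ _ _ _ sjX sj'X; rewrite leqNgt mmX.
by left; split=> // j; apply/negP.
Qed.
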